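(* Let $M$ be a matroid on a ground set with $n$ elements and let $C$ be a circuit of $M$. Then the sequence $\beta_C(1),\beta_C(2),\dots,\beta_C(n)$ of timed winning probabilities is log-concave.
   Context: Matroid bingo: let $M$ be a matroid on a finite set $E$ with $|E|=n$ and circuit set $\mathcal{C}$. The elements of $E$ are called out one at a time in a uniformly random order $\sigma(1),\sigma(2),\dots,\sigma(n)$ (a uniformly random permutation of $E$). A circuit $C$ wins in round $t$ if $C\subseteq\{\sigma(1),\dots,\sigma(t)\}$ and no circuit of $M$ is contained in $\{\sigma(1),\dots,\sigma(t-1)\}$; thus the winner is the first circuit to be completed (the circuit axioms guarantee that there is no tie). $\beta_C(t)$ denotes the probability that $C$ wins in round $t$ ($1\le t\le n$). A sequence $a_1,\dots,a_n$ of real numbers is log-concave if $a_i^2\ge a_{i-1}a_{i+1}$ for every $2\le i\le n-1$. *)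

(* Defs.v *)
From HB Require Import structures.
From mathcomp Require Import all_boot all_order all_algebra.

Set Implicit Arguments.
Unset Strict Implicit.
Unset Printing Implicit Defensive.

Import Order.TTheory GRing.Theory Num.Theory.

Local Open Scope ring_scope.

Record matroid (E : finType) := Matroid {
  indep : pred {set E};
  indep0 : indep set0;
  indepS : forall I J : {set E}, I \subset J -> indep J -> indep I;
  indep_aug : forall I J : {set E}, indep I -> indep J -> (#|I| < #|J|)%N ->
    exists2 x : E, x \in J :\: I & indep (x |: I)
}.

Definition circuit (E : finType) (M : matroid E) (C : {set E}) : bool :=
  minset (fun A : {set E} => ~~ indep M A) C.

(* An injective map between finite sets of equal cardinality is bijective, so
   these are the orderings of E.  Indices start at 0: the element called in
   round t, with 1 <= t <= #|E|, is s (t - 1). *)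
Definition orderings (E : finType) : {set {ffun 'I_#|E| -> E}} :=
  [set s : {ffun 'I_#|E| -> E} | injectiveb s].

Definition called (E : finType) (s : {ffun 'I_#|E| -> E}) (t : nat) : {set E} :=
  [set s i | i : 'I_#|E| & (i < t)%N].

Definition wins (E : finType) (M : matroid E) (C : {set E})
    (s : {ffun 'I_#|E| -> E}) (t : nat) : bool :=
  (C \subset called s t) &&
  ~~ [exists D : {set E}, circuit M D && (D \subset called s t.-1)].

(* Probability of C winning in round t (meaningful for 1 <= t <= #|E|), for the
   uniform distribution on orderings. *)
Definition beta (R : realFieldType) (E : finType) (M : matroid E)
    (C : {set E}) (t : nat) : R :=
  #|[set s in orderings E | wins M C s t]|%:R / #|orderings E|%:R.

(* Log-concavity of the finite sequence a 1, ..., a n. *)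
Definition log_concave (R : realFieldType) (n : nat) (a : nat -> R) : Prop :=
  forall i : nat, (2 <= i <= n.-1)%N -> a i.-1 * a i.+1 <= a i ^+ 2.

(* Main.v *)
Require Import Defs.
From HB Require Import structures.
From mathcomp Require Import all_boot all_order all_algebra.
From mathcomp Require Import ring lra zify.

(* Fix [e] in [C].  The winner in round [t] is [C] exactly when the first [t - 1]
   elements form an independent set [I] and the last one, [x], completes [C]; the
   number of such [I] does not depend on [x], so [beta_C(t)] is proportional to
   [(t - 1)! (n - t)!] times the number of independent sets of size [t - 1]
   containing [C \ e].  Its log-concavity thus follows from Mason's strongest
   conjecture for the contraction of [M] by [C \ e], in which [e] is a loop.
   That is proved through the Lorentzian property of the homogeneous independence
   polynomial: each quadratic form obtained from it by derivatives has a single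
   positive direction.  For rank-two truncations this is Cauchy-Schwarz over the
   parallel classes.  The general case goes by induction ("trickle-down"): the
   form is the sum of those of the contractions by one element, and the
   inequalities for these combine through the solution of a Laplace equation on
   the graph of independent pairs, which is connected. *)

Set Implicit Arguments.
Unset Strict Implicit.
Unset Printing Implicit Defensive.

Import Order.TTheory GRing.Theory Num.Theory.

Local Open Scope ring_scope.

(** * Quadratic forms and graph Laplacians *)

Section QuadraticForms.

Variables (R : realFieldType) (E : finType).
Implicit Types (y : R) (b x v : E -> R) (A : E -> E -> R).

(** The form of a block matrix with corner [a], border [b] and block [A]. The variable [y] stays
    apart because the Laplacian acts on [x] alone; for symmetric [A], [grad] is half the derivative
    in [x]. *)
Definition quad a b A y x : R :=
  a * y ^+ 2 + 2 * y * (\sum_i b i * x i) + \sum_i \sum_j A i j * x i * x j.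

Definition grad b A y x i : R := y * b i + \sum_j A i j * x j.

Lemma gradD b A y x v i :
  grad b A y (fun i => x i + v i) i = grad b A y x i + \sum_j A i j * v j.
Proof.
by rewrite /grad -addrA -big_split /=; congr (_ + _); apply: eq_bigr => j _ /=; ring.
Qed.

Lemma quadD a b A y x v : (forall i j, A i j = A j i) ->
  quad a b A y (fun i => x i + v i) =
  quad a b A y x + 2 * (\sum_i v i * grad b A y x i)
    + \sum_i \sum_j A i j * v i * v j.
Proof.
move=> symA; rewrite /quad /grad.
have -> : \sum_i \sum_j A i j * (x i + v i) * (x j + v j) =
    \sum_i \sum_j A i j * x i * x j + 2 * (\sum_i v i * \sum_j A i j * x j)
      + \sum_i \sum_j A i j * v i * v j.
  have -> : 2 * (\sum_i v i * \sum_j A i j * x j) =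
      \sum_i \sum_j A i j * v i * x j + \sum_i \sum_j A i j * x i * v j.
    rewrite mulr_natl mulr2n; congr (_ + _).
      by apply: eq_bigr => i _; rewrite mulr_sumr; apply: eq_bigr => j _ /=; ring.
    rewrite exchange_big; apply: eq_bigr => i _; rewrite mulr_sumr.
    by apply: eq_bigr => j _; rewrite symA; ring.
  rewrite -!big_split /=; apply: eq_bigr => i _; rewrite -!big_split.
  by apply: eq_bigr => j _ /=; ring.
have -> : \sum_i b i * (x i + v i) = \sum_i b i * x i + \sum_i b i * v i.
  by rewrite -big_split /=; apply: eq_bigr => i _ /=; ring.
have -> : \sum_i v i * (y * b i + \sum_j A i j * x j) =
    y * (\sum_i b i * v i) + \sum_i v i * \sum_j A i j * x j.
  by rewrite mulr_sumr -big_split /=; apply: eq_bigr => i _ /=; ring.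
ring.
Qed.

(** Dirichlet energy of the graph with edge weights [A]: symmetrizing the left side in [i] and [j]
    completes the squares. *)
Lemma laplacian_form A v : (forall i j, A i j = A j i) ->
  2 * \sum_i v i * ((\sum_j A i j) * v i - \sum_j A i j * v j) =
  \sum_i \sum_j A i j * (v i - v j) ^+ 2.
Proof.
move=> symA.
have -> : \sum_i v i * ((\sum_j A i j) * v i - \sum_j A i j * v j) =
    \sum_i \sum_j A i j * (v i ^+ 2 - v i * v j).
  apply: eq_bigr => i _; rewrite mulr_suml -sumrB mulr_sumr.
  by apply: eq_bigr => j _ /=; ring.
rewrite mulr_natl mulr2n {2}exchange_big -big_split /=; apply: eq_bigr => i _ /=.
by rewrite -big_split /=; apply: eq_bigr => j _ /=; rewrite (symA j i); ring.
Qed.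

Lemma laplacian_ker A v : (forall i j, A i j = A j i) ->
  (forall i j, 0 <= A i j) ->
  (forall i, (\sum_j A i j) * v i - \sum_j A i j * v j = 0) ->
  forall i j, 0 < A i j -> v i = v j.
Proof.
move=> symA A_ge0 Lv0 i j Aij.
have := laplacian_form v symA; rewrite big1 ?mulr0 => [/esym|k _]; last first.
  by rewrite Lv0 mulr0.
have term_ge0 k l : 0 <= A k l * (v k - v l) ^+ 2.
  by rewrite mulr_ge0 ?sqr_ge0.
move/eqP; rewrite psumr_eq0 => [/allP/(_ i)|k _]; last exact: sumr_ge0.
rewrite mem_index_enum => /(_ isT) /=; rewrite psumr_eq0 // => /allP/(_ j).
rewrite mem_index_enum => /(_ isT) /=.
by rewrite mulf_eq0 gt_eqF //= sqrf_eq0 subr_eq0 => /eqP.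
Qed.

(* Fredholm alternative: the Laplacian is symmetric, so its range is the
   orthogonal complement of its kernel. *)
Lemma laplacian_solve A (h : E -> R) : (forall i j, A i j = A j i) ->
  (forall i j, 0 <= A i j) ->
  (forall u : E -> R, (forall i j, 0 < A i j -> u i = u j) ->
     \sum_i u i * h i = 0) ->
  exists v : E -> R, forall i, (\sum_j A i j) * v i - \sum_j A i j * v j = h i.
Proof.
move=> symA A_ge0 h_orth.
pose T := enum_val : 'I_#|E| -> E.
have sumT (F : E -> R) : \sum_i F (T i) = \sum_i F i.
  by rewrite [RHS](reindex T) //; exact/onW_bij/enum_val_bij.
pose L := \matrix_(i, j) ((i == j)%:R * (\sum_l A (T i) l) - A (T i) (T j)).
have Lapp (u : 'I_#|E| -> R) i : \sum_j L i j * u j =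
    (\sum_l A (T i) l) * u i - \sum_j A (T i) (T j) * u j.
  under eq_bigr => j _ do rewrite mxE mulrBl.
  rewrite sumrB; congr (_ - _); rewrite (bigD1 i) //= eqxx mul1r [X in _ + X]big1 ?addr0 //.
  by move=> j /negPf; rewrite eq_sym => ->; rewrite !mul0r.
have symL i j : L i j = L j i.
  rewrite !mxE eq_sym symA; congr (_ - _).
  by case: eqP => [->|]; rewrite ?mul0r.
pose hv := \row_i h (T i).
have /submxP [w hw] : (hv <= L)%MS.
  (* The columns of [cokermx L] test membership in the row space; each is killed by [L], hence
     constant along edges and orthogonal to [h]. *)
  rewrite submxE; apply/eqP/rowP => c; rewrite !mxE.
  pose u i := cokermx L (enum_rank i) c.
  have uT i : u (T i) = cokermx L i c by rewrite /u enum_valK.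
  have ukerL i : \sum_j L i j * u (T j) = 0.
    have /matrixP/(_ i c) := mulmx_coker L; rewrite !mxE => {2}<-.
    by apply: eq_bigr => j _; rewrite uT.
  rewrite -[RHS](h_orth u); last first.
    apply: laplacian_ker => // i; have := ukerL (enum_rank i).
    rewrite (Lapp (u \o T)) /= !/T enum_rankK.
    by rewrite (sumT (fun j => A i j * u j)).
  by rewrite -sumT; apply: eq_bigr => i _; rewrite mxE uT mulrC.
exists (fun i => w 0 (enum_rank i)) => i.
have /matrixP/(_ 0 (enum_rank i)) := hw; rewrite !mxE /T enum_rankK => ->.
under [RHS]eq_bigr => j _ do rewrite mulrC symL.
rewrite Lapp /T enum_rankK; congr (_ - _); rewrite -sumT.
by apply: eq_bigr => j _; rewrite /T enum_valK.
Qed.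

(* With [v] a solution of the Laplace equation [D v - A v = - grad x], the
   gradient at [x - v] is [- D v], so [hquad] bounds the form there by
   [<v, D v>]; shifting back by [v] leaves at most [- <v, (D - A) v>]. *)
Lemma trickle_down a b A y x : (forall i j, A i j = A j i) ->
  (forall i j, 0 <= A i j) ->
  (forall x', quad a b A y x' <=
     \sum_i grad b A y x' i ^+ 2 / (\sum_j A i j)) ->
  (forall u : E -> R, (forall i j, 0 < A i j -> u i = u j) ->
     \sum_i u i * grad b A y x i = 0) ->
  quad a b A y x <= 0.
Proof.
move=> symA A_ge0 hquad h_orth.
have [|v Lv] := @laplacian_solve A (fun i => - grad b A y x i) symA A_ge0.
  move=> u /h_orth u0; under eq_bigr do rewrite mulrN.
  by rewrite sumrN u0 oppr0.
pose x' i := x i - v i.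
have gradx' i : grad b A y x' i = - ((\sum_j A i j) * v i).
  rewrite (gradD b A y x (fun i => - v i)).
  under eq_bigr => j _ do rewrite mulrN.
  by rewrite sumrN; have := Lv i; lra.
have -> : quad a b A y x = quad a b A y (fun i => x' i + v i).
  rewrite /quad; congr (_ + _ + _).
    by congr (_ * _); apply: eq_bigr => i _; rewrite subrK.
  by apply: eq_bigr => i _; apply: eq_bigr => j _; rewrite !subrK.
rewrite quadD //.
have := hquad x'.
have -> : \sum_i grad b A y x' i ^+ 2 / (\sum_j A i j) =
    \sum_i (\sum_j A i j) * v i ^+ 2.
  apply: eq_bigr => i _; rewrite gradx'.
  (* A row of zero sum contributes zero on both sides, since dividing by zero gives zero. *)
  by have [->|nz] := eqVneq (\sum_j A i j) 0; [ring | field].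
have -> : \sum_i v i * grad b A y x' i = - \sum_i (\sum_j A i j) * v i ^+ 2.
  by rewrite -sumrN; apply: eq_bigr => i _; rewrite gradx'; ring.
have : 0 <= 2 * \sum_i v i * ((\sum_j A i j) * v i - \sum_j A i j * v j).
  rewrite laplacian_form //; apply: sumr_ge0 => i _; apply: sumr_ge0 => j _.
  by rewrite mulr_ge0 ?sqr_ge0.
have -> : \sum_i v i * ((\sum_j A i j) * v i - \sum_j A i j * v j) =
   \sum_i (\sum_j A i j) * v i ^+ 2 - \sum_i \sum_j A i j * v i * v j.
  rewrite -sumrB; apply: eq_bigr => i _; rewrite mulrBr mulr_sumr; congr (_ - _).
    by ring.
  by apply: eq_bigr => j _ /=; ring.
lra.
Qed.

(* If the form is nonpositive on the hyperplane polar to [1], the reversed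
   Cauchy-Schwarz inequality holds against [1]. *)
Lemma reverse_CS a b A y x : (forall i j, A i j = A j i) ->
  let w := \sum_i \sum_j A i j in 0 < w ->
  (forall x', \sum_i grad b A y x' i = 0 -> quad a b A y x' <= 0) ->
  quad a b A y x * w <= (\sum_i grad b A y x i) ^+ 2.
Proof.
move=> symA w w_gt0 neg.
(* Subtracting the constant [t] from [x] makes the gradient sum to zero. *)
pose l := \sum_i grad b A y x i; pose t := l / w.
have := neg (fun i => x i + - t); rewrite quadD //.
have -> : \sum_i grad b A y (fun i => x i + - t) i = l - t * w.
  rewrite /l mulrC /w mulr_suml -sumrB; apply: eq_bigr => i _.
  by rewrite gradD mulr_suml -sumrN; congr (_ + _); apply: eq_bigr => j _ /=; ring.
rewrite -mulr_sumr -/l.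
have -> : \sum_i \sum_j A i j * - t * - t = t ^+ 2 * w.
  rewrite mulr_sumr; apply: eq_bigr => i _; rewrite mulr_sumr.
  by apply: eq_bigr => j _ /=; ring.
have w0 : w != 0 by rewrite gt_eqF.
rewrite /t divfK // subrr => /(_ erefl).
have -> : quad a b A y x + 2 * (- (l / w) * l) + (l / w) ^+ 2 * w =
  quad a b A y x - l ^+ 2 / w by field.
by rewrite subr_le0 ler_pdivlMr.
Qed.

End QuadraticForms.

(** * Independent sequences and their extensions *)

Section IndependentSequences.

Variables (E : finType) (M : matroid E).
Implicit Types (s t : seq E).

Definition indep_seq s : bool := uniq s && indep M [set x in s].

Lemma indep_seq_perm s t : perm_eq s t -> indep_seq s = indep_seq t.
Proof.
move=> st; rewrite /indep_seq (perm_uniq st); congr (_ && indep M _).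
by apply/setP => x; rewrite !inE (perm_mem st).
Qed.

Lemma indep_seq_cons x s : indep_seq (x :: s) -> indep_seq s.
Proof.
rewrite /indep_seq /= => /andP[/andP[_ ->]]; apply: indepS.
by apply/subsetP => z; rewrite !inE => ->; rewrite orbT.
Qed.

Lemma indep_seq_swap x y s : indep_seq (x :: y :: s) = indep_seq (y :: x :: s).
Proof. by apply: indep_seq_perm; rewrite (perm_catCA [:: x] [:: y]). Qed.

Lemma indep_seq_xx x s : indep_seq (x :: x :: s) = false.
Proof. by rewrite /indep_seq /= inE eqxx. Qed.

Lemma indep_seq_aug s t : indep_seq s -> indep_seq t ->
  (size s < size t)%N -> exists2 x, x \in t & indep_seq (x :: s).
Proof.
move=> /andP[us si] /andP[ut ti] ltst.
have cardE u : uniq u -> #|[set x in u]| = size u.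
  by move=> uu; rewrite cardsE (card_uniqP uu).
have [|x] := indep_aug si ti; first by rewrite !cardE.
rewrite !inE => /andP[xs xt] ix; exists x => //.
rewrite /indep_seq /= xs us /=.
by apply: indepS ix; apply/subsetP => z; rewrite !inE.
Qed.

(** Augmenting [j :: s] from [l :: i :: s] must add [l] or [i]. So in the contraction by [s] a
    nonloop is never parallel to both members of an independent pair, which makes parallelism
    transitive. *)
Lemma indep_seq_exchange i j l s : indep_seq (l :: i :: s) ->
  indep_seq (j :: s) -> indep_seq (l :: j :: s) || indep_seq (i :: j :: s).
Proof.
move=> lis js; have [|x] := indep_seq_aug js lis; first by [].
rewrite !inE => /or3P[/eqP->|/eqP->|xs]; [by move-> | by move->; rewrite orbT |].
by rewrite /indep_seq /= inE xs orbT.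
Qed.

(* The number of [k]-tuples [t] with [t ++ s] independent and repetition-free:
   [k!] times the number of independent [(size s + k)]-sets containing [s]. *)
Fixpoint nb_ext k s : nat :=
  if k is k'.+1 then \sum_(x : E) nb_ext k' (x :: s) else indep_seq s.

Lemma nb_ext_perm k s t : perm_eq s t -> nb_ext k s = nb_ext k t.
Proof.
elim: k s t => [|k IHk] s t st /=; first by rewrite (indep_seq_perm st).
by apply: eq_bigr => x _; apply: IHk; rewrite perm_cons.
Qed.

Lemma nb_ext_swap k x y s : nb_ext k (x :: y :: s) = nb_ext k (y :: x :: s).
Proof. by apply: nb_ext_perm; rewrite (perm_catCA [:: x] [:: y]). Qed.

Lemma nb_ext_dep k s : ~~ indep_seq s -> nb_ext k s = 0%N.
Proof.
elim: k s => [|k IHk] s ns /=; first by rewrite (negPf ns).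
by rewrite big1 // => x _; apply: IHk; apply: contra ns; apply: indep_seq_cons.
Qed.

Lemma nb_ext_indep k s : (0 < nb_ext k s)%N -> indep_seq s.
Proof. by apply: contraLR => /(nb_ext_dep k)->. Qed.

Lemma nb_ext_witness k s : (0 < nb_ext k s)%N ->
  exists2 t, indep_seq t & size t = (size s + k)%N.
Proof.
elim: k s => [|k IHk] s /=.
  by rewrite addn0; case: (boolP (indep_seq s)) => // si _; exists s.
rewrite lt0n sum_nat_eq0 => /forallPn[x]; rewrite -lt0n => /IHk[t it st].
by exists t; rewrite // st addSnnS.
Qed.

Lemma nb_ext_gt0 k s t : indep_seq s -> indep_seq t ->
  size t = (size s + k)%N -> (0 < nb_ext k s)%N.
Proof.
move=> + it; elim: k s => [|k IHk] s si st /=; first by rewrite si.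
have [|x _ ix] := indep_seq_aug si it; first by rewrite st addnS leq_addr.
by rewrite (bigD1 x) //= ltn_addr // IHk // st addSnnS.
Qed.

(** For independent sequences only the total length matters: extensions exist exactly when some
    independent sequence is that long. *)
Lemma nb_ext_gt0W k m s t : (0 < nb_ext k s)%N -> indep_seq t ->
  (size t + m = size s + k)%N -> (0 < nb_ext m t)%N.
Proof.
by move=> /nb_ext_witness[u iu su] it st; apply: (nb_ext_gt0 it iu); rewrite su.
Qed.

Definition nonloops s : {set E} := [set x | indep_seq (x :: s)].

Lemma card_nonloops_cons x s : indep_seq (x :: s) ->
  (#|nonloops (x :: s)| < #|nonloops s|)%N.
Proof.
move=> xs; apply: proper_card; apply/properP; split.
  apply/subsetP => z; rewrite !inE indep_seq_swap; exact: indep_seq_cons.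
by exists x; rewrite !inE ?xs // indep_seq_xx.
Qed.

End IndependentSequences.

(** * Signature of the Hessians and log-concavity *)

Section Hyperbolicity.

Variables (R : realFieldType) (E : finType) (M : matroid E).
Implicit Types (s : seq E).

Local Notation nb_ext := (nb_ext M).
Local Notation indep_seq := (indep_seq M).
Local Notation nonloops := (nonloops M).

(* Up to the factor [r!], the Hessian of the [k]-th derivative in direction
   [(0, 1, .., 1)] of [sum_I (r + j)!/j! y^j x^(I \ s)], where [I] ranges over
   the independent sets containing [s] and [j = k + 2 - #|I \ s|]. *)
Definition hess_yy r k s : R := (r.+2 * r.+1 * nb_ext k s)%:R.
Definition hess_y r k s (i : E) : R := (r.+1 * nb_ext k (i :: s))%:R.
Definition hess k s (i j : E) : R := (nb_ext k (j :: i :: s))%:R.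

Local Notation qf r k s := (quad (hess_yy r k s) (hess_y r k s) (hess k s)).
Local Notation gf r k s := (grad (hess_y r k s) (hess k s)).

Lemma hess_sym k s i j : hess k s i j = hess k s j i.
Proof. by rewrite /hess nb_ext_swap. Qed.

Lemma hess_ge0 k s i j : 0 <= hess k s i j.
Proof. exact: ler0n. Qed.

Lemma sum_hess k s i : \sum_j hess k s i j = (nb_ext k.+1 (i :: s))%:R.
Proof. by rewrite /= natr_sum. Qed.

Lemma sum_sum_hess k s : \sum_i \sum_j hess k s i j = (nb_ext k.+2 s)%:R.
Proof.
by rewrite [in RHS]/= natr_sum; apply: eq_bigr => i _; rewrite sum_hess.
Qed.

Lemma sum_hess_y r k s : \sum_i hess_y r k s i = (r.+1 * nb_ext k.+1 s)%:R.
Proof. by rewrite -natr_sum -big_distrr. Qed.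

(** Contracting [i] differentiates along [i]. This identity turns the bound of [reverse_CS] for each
    contraction into the hypothesis of [trickle_down]. *)
Lemma sum_grad_cons r k s i y x :
  \sum_j gf r k (i :: s) y x j = gf r k.+1 s y x i.
Proof.
rewrite /grad big_split -mulr_sumr sum_hess_y exchange_big /=; congr (_ + _).
apply: eq_bigr => j _; rewrite -mulr_suml -natr_sum /=; congr (_%:R * _).
by apply: eq_bigr => l _; rewrite nb_ext_swap.
Qed.

Lemma sum_quad_cons r k s y x :
  \sum_i qf r k (i :: s) y x = qf r k.+1 s y x.
Proof.
rewrite /quad !big_split -mulr_suml -mulr_sumr /=; congr (_ * _ + _ * _ + _).
- by rewrite -natr_sum -big_distrr.
- rewrite exchange_big; apply: eq_bigr => j _ /=.
  rewrite -mulr_suml -natr_sum -big_distrr /hess_y /=; congr ((_ * _)%:R * _).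
  by apply: eq_bigr => i _; rewrite nb_ext_swap.
rewrite exchange_big; apply: eq_bigr => j _ /=.
rewrite exchange_big; apply: eq_bigr => l _ /=.
rewrite -!mulr_suml -natr_sum /hess /=; congr (_%:R * _ * _).
apply: eq_bigr => i _; apply: nb_ext_perm.
by rewrite (perm_catCA [:: l; j] [:: i]).
Qed.

(** Connectedness of the graph of independent pairs: nonadjacent nonloops [i] and [j] are parallel,
    so any neighbour [l] of [i] is also one of [j]. *)
Lemma hess_const k s (u : E -> R) : (0 < nb_ext k.+2 s)%N ->
  (forall i j, 0 < hess k s i j -> u i = u j) ->
  {in nonloops s &, forall i j, u i = u j}.
Proof.
move=> W0 u_const.
have edge i j : indep_seq (j :: i :: s) -> u i = u j.
  move=> jis; apply: u_const; rewrite ltr0n.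
  by apply: (nb_ext_gt0W W0 jis); rewrite /= !addSnnS.
move=> i j; rewrite !inE => si sj.
have [/edge//|nji] := boolP (indep_seq (j :: i :: s)).
have [t it st] := nb_ext_witness W0.
have [|l _ lis] := indep_seq_aug si it; first by rewrite st /=; lia.
rewrite (edge _ _ lis); apply/esym/edge.
have /orP[//|] := indep_seq_exchange lis sj.
by rewrite indep_seq_swap (negPf nji).
Qed.

Lemma quad_dep r k s y x : ~~ indep_seq s -> qf r k s y x = 0.
Proof.
move=> ns; have nxs z : ~~ indep_seq (z :: s).
  by apply: contra ns; apply: indep_seq_cons.
rewrite /quad /hess_yy nb_ext_dep // muln0 mul0r add0r.
rewrite !big1 ?mulr0 ?add0r // => i _.
  rewrite big1 // => j _; rewrite /hess nb_ext_dep ?mul0r //.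
  by apply: contra (nxs i); apply: indep_seq_cons.
by rewrite /hess_y nb_ext_dep // muln0 mul0r.
Qed.

Lemma grad_dep r k s y x i : ~~ indep_seq (i :: s) -> gf r k s y x i = 0.
Proof.
move=> ns; rewrite /grad /hess_y nb_ext_dep // muln0 mulr0 add0r big1 // => j _.
rewrite /hess nb_ext_dep ?mul0r //; apply: contra ns; exact: indep_seq_cons.
Qed.

Lemma quad_step r k s : (0 < nb_ext k.+3 s)%N ->
  (forall i y x, (0 < nb_ext k.+2 (i :: s))%N ->
     \sum_j gf r k (i :: s) y x j = 0 -> qf r k (i :: s) y x <= 0) ->
  forall y x, \sum_i gf r k.+1 s y x i = 0 -> qf r k.+1 s y x <= 0.
Proof.
move=> W0 IH y x g0; apply: trickle_down.
- exact: hess_sym.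
- exact: hess_ge0.
- move=> x'; rewrite -sum_quad_cons; apply: ler_sum => i _.
  rewrite sum_hess -sum_grad_cons.
  have [d0|d_gt0] := posnP (nb_ext k.+2 (i :: s)).
    (* Without extensions [i :: s] must be dependent, by [W0], and its form is zero. *)
    rewrite d0 invr0 mulr0 quad_dep //; apply/negP => si.
    have : (0 < nb_ext k.+2 (i :: s))%N.
      by apply: (nb_ext_gt0W W0 si); rewrite /= addSnnS.
    by rewrite d0.
  rewrite ler_pdivlMr ?ltr0n // -sum_sum_hess.
  apply: reverse_CS => [||x'' /IH]; [exact: hess_sym | | exact].
  by rewrite sum_sum_hess ltr0n.
(* Since [u] is constant on the nonloops and the gradient vanishes elsewhere, the pairing is a
   multiple of the sum in [g0]. *)
move=> u /(hess_const W0) u_const.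
have [nl0|[i0 si0]] := set_0Vmem (nonloops s).
  apply: big1 => i _; rewrite grad_dep ?mulr0 //.
  by have := in_set0 i; rewrite -nl0 inE => ->.
transitivity (u i0 * \sum_i gf r k.+1 s y x i); last by rewrite g0 mulr0.
rewrite mulr_sumr; apply: eq_bigr => i _.
have [si|] := boolP (i \in nonloops s); first by rewrite (u_const i i0).
by rewrite inE => ni; rewrite grad_dep ?mulr0.
Qed.

(* On the hyperplane [y = - S / (r + 2)] with [S] the sum of [x] over the
   nonloops, the form is [S^2 / (r + 2)] minus the sum of [S_c^2] over the
   parallel classes [c], of which there are at most [r + 2]. *)
Lemma quad_base r s : (0 < nb_ext 2 s)%N -> (#|nonloops s| <= r.+2)%N ->
  forall y x, \sum_i gf r 0 s y x i = 0 -> qf r 0 s y x <= 0.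
Proof.
move=> W0 card_nl y x g0; pose F := nonloops s.
have si : indep_seq s by apply: nb_ext_indep W0.
have FP i : (i \in F) = indep_seq (i :: s) by rewrite inE.
(* A representative of the parallel class of [i]: the choice depends only on the predicate, so
   parallel elements share it. On [F] the default never occurs, as [i] itself qualifies. *)
pose rho i := odflt i [pick l in F | ~~ indep_seq (l :: i :: s)].
have rhoP i : i \in F -> (rho i \in F) /\ ~~ indep_seq (rho i :: i :: s).
  move=> Fi; rewrite /rho; case: pickP => [l /andP[]//|/(_ i)].
  by rewrite Fi indep_seq_xx.
have hessE i j : i \in F -> j \in F -> hess 0 s i j = 1 - (rho i == rho j)%:R.
  move=> Fi Fj; rewrite /hess /=.
  have [rij|/eqP rij] := eqVneq (rho i) (rho j).
    rewrite subrr; have [Fl li] := rhoP i Fi; have [_ lj] := rhoP j Fj.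
    case: (boolP (indep_seq _)) => // jis; rewrite FP in Fl.
    have := indep_seq_exchange jis Fl.
    by rewrite ![indep_seq [:: _, rho i & s]]indep_seq_swap {1}rij (negPf lj) (negPf li).
  rewrite subr0; case: (boolP (indep_seq _)) => // nji; case: rij; rewrite /rho.
  have par_le a b c : ~~ indep_seq (b :: a :: s) -> a \in F -> b \in F ->
      indep_seq (c :: a :: s) -> indep_seq (c :: b :: s).
    rewrite !FP => nba _ Fb ca; have /orP[//|] := indep_seq_exchange ca Fb.
    by rewrite indep_seq_swap (negPf nba).
  rewrite (@eq_pick _ _ [pred l in F | ~~ indep_seq (l :: j :: s)]).
    case: pickP => // /(_ j); rewrite /= Fj indep_seq_xx //.
  move=> l /=; congr (_ && ~~ _); apply/idP/idP; apply: par_le => //.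
  by rewrite indep_seq_swap.
pose Sc x' c := \sum_(i in F | rho i == c) x' i : R.
have sumSc x' : \sum_(c in F) Sc x' c = \sum_(i in F) x' i.
  by rewrite [RHS](partition_big rho (mem F)) // => i /rhoP[].
have hess_nl i j : hess 0 s i j = hess 0 s i j *+ (i \in F) *+ (j \in F).
  rewrite /hess /= !FP; case: (boolP (indep_seq (j :: i :: s))) => [jis|].
    rewrite (indep_seq_cons jis); rewrite indep_seq_swap in jis.
    by rewrite (indep_seq_cons jis).
  by rewrite !mul0rn.
have sum_hess_sq x' : \sum_i \sum_j hess 0 s i j * x' i * x' j =
    (\sum_(i in F) x' i) ^+ 2 - \sum_(c in F) Sc x' c ^+ 2.
  transitivity (\sum_(i in F) \sum_(j in F) hess 0 s i j * x' i * x' j).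
    rewrite [RHS]big_mkcond; apply: eq_bigr => i _.
    rewrite [in RHS]big_mkcond -[if _ then _ else _]mulrb -sumrMnl.
    apply: eq_bigr => j _; rewrite hess_nl -mulrb.
    by case: (i \in F); case: (j \in F); rewrite ?(mulr0n, mulr1n, mul0r, mul0rn).
  have -> : \sum_(c in F) Sc x' c ^+ 2 = \sum_(i in F) x' i * Sc x' (rho i).
    rewrite [RHS](partition_big rho (mem F)) => [|i /rhoP[]//].
    apply: eq_bigr => c Fc; rewrite expr2 {1}/Sc mulr_suml.
    by apply: eq_bigr => i /andP[_ /eqP->].
  rewrite expr2 mulr_suml -sumrB; apply: eq_bigr => i Fi.
  rewrite -mulrBr /Sc big_mkcondr -sumrB mulr_sumr; apply: eq_bigr => j Fj.
  rewrite hessE // (eq_sym (rho j)); case: eqP => _ /=; ring.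
have qE z x' : qf r 0 s z x' = r.+2%:R * r.+1%:R * z ^+ 2
   + 2 * z * (r.+1%:R * \sum_(i in F) x' i)
   + ((\sum_(i in F) x' i) ^+ 2 - \sum_(c in F) Sc x' c ^+ 2).
  rewrite /quad sum_hess_sq /hess_yy /= si muln1 natrM; congr (_ + _ * _ + _).
  rewrite mulr_sumr [RHS]big_mkcond; apply: eq_bigr => i _.
  by rewrite /hess_y /= FP natrM; case: (indep_seq _); rewrite ?mulr1 ?mulr0 ?mul0r.
have q_le0 x' : r.+2%:R * y + \sum_(i in F) x' i = 0 -> qf r 0 s y x' <= 0.
  rewrite qE -sumSc => hy; set m : R := r.+2%:R in hy *.
  have m_gt0 : 0 < m by rewrite ltr0n.
  have -> : r.+1%:R = m - 1 by rewrite /m -[in RHS]natr1 addrK.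
  (* Nonrepresentatives have an empty class sum and add [y ^+ 2] each, so the sum may run over all
     of [F]. *)
  have : 0 <= \sum_(c in F) (Sc x' c + y) ^+ 2.
    by apply: sumr_ge0 => c _; apply: sqr_ge0.
  have -> : \sum_(c in F) (Sc x' c + y) ^+ 2 = \sum_(c in F) Sc x' c ^+ 2
      + 2 * y * (\sum_(c in F) Sc x' c) + #|F|%:R * y ^+ 2.
    rewrite -sum1_card natr_sum mulr_sumr mulr_suml -!big_split.
    by apply: eq_bigr => c _ /=; ring.
  have : #|F|%:R * y ^+ 2 <= m * y ^+ 2 by rewrite ler_wpM2r ?sqr_ge0 ?ler_nat.
  have -> : \sum_(c in F) Sc x' c = - (m * y) by lra.
  nra.
have F_gt0 : (0 < #|F|)%N.
  move: W0; rewrite [nb_ext 2 s]/= lt0n sum_nat_eq0 => /forallPn[i].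
  rewrite -lt0n => /(@nb_ext_indep _ M 1) Fi.
  by apply/card_gt0P; exists i; rewrite FP.
(* The hyperplane of [q_le0] differs from that of [g0]. Shifting [x] by [- t] reaches it; [g0] kills
   the cross term, so the form can only grow. *)
pose t := (r.+2%:R * y + \sum_(i in F) x i) / #|F|%:R.
have := q_le0 (fun i => x i + - t).
rewrite big_split sumr_const /= -(mulr_natr (- t)) mulNr [in X in - X]/t divfK; last first.
  by rewrite pnatr_eq0 -lt0n.
rewrite addrA subrr => /(_ erefl).
rewrite quadD; last exact: hess_sym.
rewrite -mulr_sumr g0 !mulr0 addr0; apply: le_trans; rewrite lerDl.
apply: sumr_ge0 => i _; apply: sumr_ge0 => j _.
by rewrite -mulrA mulr_ge0 ?hess_ge0 // -expr2 sqr_ge0.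
Qed.

(* The forms in dimension [k] are the derivatives of the one in dimension
   [k + 1], along the contractions of [M] by single elements. *)
Lemma quad_le0 r k s : (0 < nb_ext k.+2 s)%N ->
  (#|nonloops s| <= r.+2 + k)%N ->
  forall y x, \sum_i gf r k s y x i = 0 -> qf r k s y x <= 0.
Proof.
elim: k s => [|k IHk] s W0 card_nl; first by rewrite addn0 in card_nl; exact: quad_base.
apply: quad_step => // i y x Wi; apply: IHk => //.
have := card_nonloops_cons (nb_ext_indep Wi).
by move/leq_trans/(_ card_nl); rewrite addnS.
Qed.

(** This is [reverse_CS] at the point [y = 1], [x = 0], after cancelling [r.+1]. *)
Lemma nb_ext_log_concave r k s : (#|nonloops s| <= r.+2 + k)%N ->
  (r.+2 * (nb_ext k s * nb_ext k.+2 s) <= r.+1 * nb_ext k.+1 s ^ 2)%N.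
Proof.
move=> card_nl; have [->|W0] := posnP (nb_ext k.+2 s); first by rewrite !muln0.
have := @reverse_CS R E (hess_yy r k s) (hess_y r k s) (hess k s) 1 (fun=> 0).
cbv zeta; rewrite sum_sum_hess ltr0n W0 => /(_ (hess_sym _ _) isT).
move/(_ (@quad_le0 _ _ _ W0 card_nl _)).
have -> : qf r k s 1 (fun=> 0) = hess_yy r k s.
  rewrite /quad !big1 => [||i _]; first by ring.
    by move=> i _; rewrite big1 // => j _; rewrite mulr0.
  by rewrite mulr0.
have -> : \sum_i gf r k s 1 (fun=> 0) i = (r.+1 * nb_ext k.+1 s)%:R.
  rewrite -sum_hess_y; apply: eq_bigr => i _.
  by rewrite /grad big1 => [|j _]; rewrite ?mulr0 // addr0 mul1r.
rewrite -natrM -natrX ler_nat -!mulnn.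
move: (nb_ext k s) (nb_ext k.+1 s) (nb_ext k.+2 s) => u v w le_uw.
by rewrite -(@leq_pmul2l r.+1) //; lia.
Qed.

End Hyperbolicity.

(** * Independent sets above a given set, and exchange in a circuit *)

Section IndependentSupersets.

Variables (E : finType) (M : matroid E).
Implicit Types (s : seq E) (A C I : {set E}).

Definition indep_above A m : {set {set E}} :=
  [set I | [&& indep M I, A \subset I & #|I| == m]].

(** Double counting of the pairs of a set [I] and an element [x] of [I :\: A]. *)
Lemma sum_indep_above A m :
  (\sum_(x in ~: A) #|indep_above (x |: A) m| = (m - #|A|) * #|indep_above A m|)%N.
Proof.
under eq_bigr => x _ do rewrite -sum1_card.
rewrite (exchange_big_dep (mem (indep_above A m))) /=; last first.
  move=> x I _; rewrite !inE => /and3P[-> /subUsetP[_ ->] ->] //.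
rewrite mulnC -sum_nat_const; apply: eq_bigr => I; rewrite inE.
case/and3P=> iI AI /eqP <-.
rewrite -cardsDS // -[RHS]sum1_card; apply: eq_bigl => x.
by rewrite !inE iI subUset sub1set AI eqxx !andbT.
Qed.

Lemma nb_extE k s : indep_seq M s ->
  nb_ext M k s = (k`! * #|indep_above [set x in s] (size s + k)|)%N.
Proof.
elim: k s => [|k IHk] s si.
  rewrite /= si mul1n addn0; have /andP[us iS] := si.
  have szs : size s = #|[set x in s]| by rewrite cardsE (card_uniqP us).
  apply/esym/eqP/cards1P; exists [set x in s]; apply/setP => I; rewrite !inE szs.
  apply/and3P/eqP => [[_ sI /eqP cI]|->]; last by rewrite iS subxx eqxx.
  by apply/esym/eqP; rewrite eqEcard sI cI leqnn.
have /andP[us iS] := si.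
have szs : size s = #|[set x in s]| by rewrite cardsE (card_uniqP us).
have := sum_indep_above [set x in s] (size s + k.+1)%N.
rewrite -szs addKn factS mulnAC => <-; rewrite big_distrl /=.
rewrite [RHS]big_mkcond; apply: eq_bigr => x _; rewrite !inE.
have [xs|nxs] /= := boolP (x \in s).
  by apply: nb_ext_dep; rewrite /indep_seq /= xs.
have eqS : [set y in x :: s] = x |: [set y in s].
  by apply/setP => y; rewrite !inE.
have [ixs|nixs] := boolP (indep_seq M (x :: s)).
  by rewrite IHk // eqS /= addSnnS mulnC.
rewrite nb_ext_dep // (_ : indep_above _ _ = set0) ?cards0 //.
apply/setP => I; rewrite !inE; apply: contraNF nixs => /and3P[iI sI _].
by rewrite /indep_seq /= nxs us eqS (indepS sI iI).
Qed.

(** Mason's inequality for the contraction by [A], with factors [1 + 1/(k+1)] and [1 + 1/(r+1)]. *)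
Lemma indep_above_log_concave r k A
    (N := fun m : nat => #|indep_above A (#|A| + m)%N|) : indep M A ->
  (#|[set x | x \notin A & indep M (x |: A)]| <= r.+2 + k)%N ->
  (r.+2 * k.+2 * (N k * N k.+2) <= r.+1 * k.+1 * N k.+1 ^ 2)%N.
Proof.
move=> iA card_nl.
have enumA : [set x in enum A] = A by apply/setP => x; rewrite inE mem_enum.
have siA : indep_seq M (enum A) by rewrite /indep_seq enum_uniq enumA.
have := @nb_ext_log_concave rat E M r k (enum A).
have -> : nonloops M (enum A) = [set x | x \notin A & indep M (x |: A)].
  apply/setP => x; rewrite !inE /indep_seq /= mem_enum enum_uniq andbT.
  by congr (_ && indep M _); apply/setP => y; rewrite !inE mem_enum.
move/(_ card_nl); rewrite !nb_extE // enumA -cardE -/(N _) -/(N _) -/(N _).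
rewrite !factS; have := fact_gt0 k.
move: (N k) (N k.+1) (N k.+2) (k`!) => u v w K K_gt0 le_uv.
have : (K * K * k.+1 * (r.+2 * k.+2 * (u * w)) <=
        K * K * k.+1 * (r.+1 * k.+1 * v ^ 2))%N.
  by move: le_uv; rewrite -!mulnn; lia.
by rewrite leq_pmul2l // !muln_gt0 K_gt0.
Qed.

Lemma circuit_dep C I : circuit M C -> indep M I -> ~~ (C \subset I).
Proof.
move=> /minsetp nC iI; apply: contra nC => CI; exact: indepS CI iI.
Qed.

Lemma circuit_indepD1 C e : circuit M C -> e \in C -> indep M (C :\ e).
Proof.
move=> /minsetP[_ minC] eC; apply/negPn/negP => /minC/(_ (subsetDl _ _)) eqC.
by have := setD11 e C; rewrite eqC eC.
Qed.

Lemma indep_supset A I m : indep M A -> indep M I -> (#|A| <= m <= #|I|)%N ->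
  exists2 J, J \in indep_above A m & J \subset A :|: I.
Proof.
move=> iA iI; elim: m => [|m IHm] /andP[Am mI].
  by exists A; rewrite ?subsetUl // inE iA subxx -leqn0.
have [Am1|Am1] := eqVneq #|A| m.+1.
  by exists A; rewrite ?subsetUl // inE iA subxx Am1 eqxx.
have [|J] := IHm; first by rewrite (ltnW mI) andbT -ltnS ltn_neqAle Am1.
rewrite inE => /and3P[iJ AJ /eqP cJ] JAI.
have [|x] := indep_aug iJ iI; first by rewrite cJ.
rewrite inE => /andP[xJ xI] ixJ; exists (x |: J).
  by rewrite inE ixJ cardsU1 xJ cJ eqxx (subset_trans AJ) ?subsetUr.
by rewrite subUset sub1set inE xI orbT.
Qed.

(** Trading [e'] for [e] is injective. To see that [swap I] is independent, grow [C :\ e'] from [I]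
    to a set [J] of size [m]: it avoids [e'], as it cannot contain [C], so it lies in [swap I] and
    equals it by cardinality. *)
Lemma card_indep_above_circuit C e e' m : circuit M C -> e \in C -> e' \in C ->
  #|indep_above (C :\ e) m| = #|indep_above (C :\ e') m|.
Proof.
move=> cC; move: e e'.
suff le_card e e' : e \in C -> e' \in C ->
    (#|indep_above (C :\ e) m| <= #|indep_above (C :\ e') m|)%N.
  by move=> e e' eC e'C; apply/eqP; rewrite eqn_leq !le_card.
move=> eC e'C; pose swap I := (e |: I) :\ e'.
have aboveP a I : a \in C -> C :\ a \subset I -> indep M I -> a \notin I.
  move=> aC CI iI; apply: contra (circuit_dep cC iI) => aI.
  by rewrite -(setD1K aC) subUset sub1set aI.
have e'_in I : C :\ e \subset I -> e' \in e |: I.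
  move=> CI; rewrite !inE; have [//|ne] := eqVneq e' e.
  by rewrite (subsetP CI) ?inE ?ne.
have swapK : {in indep_above (C :\ e) m, cancel swap (fun J => (e' |: J) :\ e)}.
  move=> I; rewrite inE => /and3P[iI CI _]; rewrite setD1K ?e'_in // setU1K //.
  exact: aboveP CI iI.
have <- : #|swap @: indep_above (C :\ e) m| = #|indep_above (C :\ e) m|.
  exact: card_in_imset (can_in_inj swapK).
apply/subset_leq_card/subsetP.
move=> _ /imsetP[I + ->]; rewrite inE => /and3P[iI CI /eqP cI].
have eI := aboveP e I eC CI iI.
have c_swap : #|swap I| = m.
  by have := cardsD1 e' (e |: I); rewrite e'_in // cardsU1 eI cI => -[].
have [|J] := @indep_supset (C :\ e') I m (circuit_indepD1 cC e'C) iI.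
  rewrite cI leqnn andbT -cI; apply: leq_trans (subset_leq_card CI).
  have := cardsD1 e C; rewrite (cardsD1 e' C) e'C eC => /eqP.
  by rewrite eqn_add2l => /eqP->.
rewrite inE => /and3P[iJ CJ /eqP cJ] JCI.
suff -> : swap I = J by rewrite inE iJ CJ cJ eqxx.
apply/esym/eqP; rewrite eqEcard c_swap cJ leqnn andbT subsetD1.
rewrite (aboveP e') // andbT; apply: subset_trans JCI _.
rewrite subUset subsetUr andbT; apply: subset_trans (subsetDl _ _) _.
by rewrite -(setD1K eC) setUS.
Qed.

Lemma indepE A : indep M A = ~~ [exists D, circuit M D && (D \subset A)].
Proof.
apply/idP/idP => [iA|].
  by apply/existsPn => D; apply/negP => /andP[cD]; apply/negP/circuit_dep.
apply: contraR => nA; apply/existsP.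
by have [D cD DA] := minset_exists (P := fun A => ~~ indep M A) nA; exists D; apply/andP.
Qed.

End IndependentSupersets.

(** * Orderings with a prescribed initial set and next element *)

Section Orderings.

Variable E : finType.
Implicit Types (f : {ffun 'I_#|E| -> E}) (p : 'I_#|E|) (I : {set E}) (u : seq E).

Lemma mem_uniq_full u x : uniq u -> size u = #|E| -> x \in u.
Proof.
move=> uu su; have /subset_leqif_cards[_] : [set y in u] \subset [set: E].
  exact: subsetT.
rewrite cardsE (card_uniqP uu) su cardsT eqxx => /esym/eqP/setP/(_ x).
by rewrite !inE.
Qed.

Lemma called_take f t : called f t = [set x in take t (codom f)].
Proof.
rewrite /codom /image_mem -map_take; apply/setP => x; rewrite inE.
have in_take_enum i : (i \in take t (enum 'I_#|E|)) = (i < t)%N.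
  by rewrite in_take ?mem_enum // index_enum_ord.
apply/imsetP/mapP => -[i it ->]; exists i => //.
  by rewrite in_take_enum; rewrite inE in it.
by rewrite inE -in_take_enum.
Qed.

Lemma called_ordS f p : called f p.+1 = f p |: called f p.
Proof.
apply/setP => x; rewrite in_setU1; apply/imsetP/orP => [[i + ->]|].
  rewrite !inE ltnS leq_eqVlt => /orP[/eqP/val_inj->|ip]; first by left.
  by right; apply/imsetP; exists i; rewrite ?inE.
case=> [/eqP->|/imsetP[i + ->]]; first by exists p; rewrite ?inE.
by rewrite inE => ip; exists i; rewrite // inE ltnW.
Qed.

Lemma nth_codom f p x : nth x (codom f) p = f p.
Proof. by rewrite (nth_map p) ?size_enum_ord // nth_ord_enum. Qed.

Lemma uniq_codom f : uniq (codom f) = (f \in orderings E).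
Proof. by rewrite inE. Qed.

Lemma size_codom_ord f : size (codom f) = #|E|.
Proof. by rewrite size_codom card_ord. Qed.

Lemma card_called f t : f \in orderings E -> (t <= #|E|)%N ->
  #|called f t| = t.
Proof.
move=> uf tE; rewrite called_take cardsE; rewrite -uniq_codom in uf.
by rewrite (card_uniqP (take_uniq t uf)) size_takel // size_codom_ord.
Qed.

(** Read as lists, these orderings are the [v ++ e :: w] with [v] listing [I] and [w] listing the
    remaining elements. *)
Lemma card_called_fibre I e p : e \notin I -> #|I| = p ->
  #|[set f in orderings E | (called f p == I) && (f p == e)]| =
  (p`! * (#|E| - p.+1)`!)%N.
Proof.
move=> eI cI; set J := ~: (e |: I).
have cJ : #|J| = (#|E| - p.+1)%N by rewrite cardsCs setCK cardsU1 eI cI.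
pose L := [seq v ++ e :: w | v <- permutations (enum I), w <- permutations (enum J)].
have size_perm v : v \in permutations (enum I) -> size v = p.
  by rewrite mem_permutations => /perm_size->; rewrite -cardE.
have <- : size L = (p`! * (#|E| - p.+1)`!)%N.
  by rewrite size_allpairs !size_permutations ?enum_uniq // -!cardE cI cJ.
rewrite cardE -(size_map (fun f => codom f)); apply: perm_size; apply: uniq_perm.
- rewrite map_inj_uniq ?enum_uniq // => f g fg; apply/ffunP => i.
  by rewrite -(nth_codom f i e) fg nth_codom.
- apply: allpairs_uniq; rewrite ?permutations_uniq // => -[v w] [v' w'].
  move=> /allpairsP[[a b] /= [va _ [-> _]]] /allpairsP[[a' b'] /= [va' _ [-> _]]].
  move/eqP; rewrite eqseq_cat ?size_perm // eqseq_cons eqxx /=.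
  by case/andP => /eqP-> /eqP->.
move=> u; apply/mapP/allpairsP => [[f]|[[v w] /= [Vv Ww ->]]].
  rewrite mem_enum !inE => /andP[uf /andP[/eqP fI /eqP fe]] ->.
  have pE : (p < size (codom f))%N by rewrite size_codom_ord.
  have def_u : codom f = take p (codom f) ++ e :: drop p.+1 (codom f).
    by rewrite -{1}fe -(nth_codom f p e) -drop_nth // cat_take_drop.
  have uc : uniq (codom f) by rewrite uniq_codom inE.
  have memI x : (x \in take p (codom f)) = (x \in I).
    by rewrite -fI called_take inE.
  exists (take p (codom f), drop p.+1 (codom f)); split=> //=.
    rewrite mem_permutations; apply: uniq_perm; rewrite ?enum_uniq ?take_uniq //.
    by move=> x; rewrite mem_enum memI.
  rewrite mem_permutations; apply: uniq_perm; rewrite ?enum_uniq ?drop_uniq //.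
  move=> x; rewrite mem_enum !inE -memI negb_or.
  have := mem_uniq_full x uc (size_codom_ord f); rewrite [in X in X -> _]def_u.
  have : uniq (take p (codom f) ++ e :: drop p.+1 (codom f)) by rewrite -def_u.
  rewrite mem_cat inE cat_uniq => /and3P[_ /hasPn Nv /= /andP[ew _]].
  have [xw _|xw] := boolP (x \in drop p.+1 (codom f)).
    by rewrite (Nv x) ?inE ?xw ?orbT // andbT; apply/esym; apply: contraNneq ew => <-.
  by rewrite orbF -negb_or orbC => ->.
set u' := v ++ e :: w.
have sv := size_perm _ Vv; rewrite !mem_permutations in Vv Ww.
have vI x : (x \in v) = (x \in I) by rewrite (perm_mem Vv) mem_enum.
have wJ x : (x \in w) = (x \in J) by rewrite (perm_mem Ww) mem_enum.
have uu : uniq u'.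
  rewrite cat_uniq (perm_uniq Vv) /= (perm_uniq Ww) !enum_uniq vI (negPf eI) wJ.
  rewrite !inE eqxx /= andbT; apply/hasPn => x; rewrite wJ !inE negb_or vI.
  by case/andP.
have su : size u' = #|E|.
  rewrite size_cat /= sv (perm_size Ww) -cardE cJ.
  by rewrite -addSnnS subnKC ?ltn_ord.
pose f : {ffun 'I_#|E| -> E} := [ffun i : 'I_#|E| => nth e u' i].
have codom_f : codom f = u'.
  apply: (@eq_from_nth _ e) => [|i]; rewrite size_codom_ord ?su // => iE.
  by rewrite (nth_codom f (Ordinal iE)) ffunE.
exists f => //; rewrite mem_enum !inE -[injectiveb f]/(uniq (codom f)) codom_f uu /=.
rewrite ffunE nth_cat sv ltnn subnn eqxx andbT called_take codom_f.
by apply/eqP/setP => x; rewrite inE take_size_cat // vI.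
Qed.

End Orderings.

(** * Counting the winning orderings *)

Section Winning.

Variables (E : finType) (M : matroid E) (C : {set E}).
Hypothesis cC : circuit M C.

Lemma wins_ordS f (p : 'I_#|E|) :
  wins M C f p.+1 = (C \subset f p |: called f p) && indep M (called f p).
Proof. by rewrite /wins /= -indepE called_ordS. Qed.

Lemma circuit_sub_setU1 e (I : {set E}) :
  (C \subset e |: I) && indep M I =
  [&& e \in C, e \notin I, indep M I & C :\ e \subset I].
Proof.
rewrite andbA andbC; have [iI|] := boolP (indep M I); rewrite ?andbF //=.
have nCI := circuit_dep cC iI.
rewrite subDset; case: (boolP (C \subset e |: I)) => CI; rewrite ?andbF //.
rewrite andbT; apply/esym/andP; split.
  apply: contraR nCI => eC; apply/subsetP => x xC.
  have := subsetP CI x xC; rewrite !inE => /orP[/eqP xe|//].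
  by rewrite -xe xC in eC.
by apply: contra nCI => eI; rewrite (setUidPr _) ?sub1set in CI.
Qed.

Lemma card_wins e (p : 'I_#|E|) : e \in C ->
  #|[set f in orderings E | wins M C f p.+1]| =
  (#|C| * (p`! * (#|E| - p.+1)`!) * #|indep_above M (C :\ e) p|)%N.
Proof.
move=> eC.
pose valid := [pred z : E * {set E} | (z.1 \in C) && (z.2 \in indep_above M (C :\ z.1) p)].
rewrite -sum1_card.
(* Orderings are sorted by the completing element and the set called before it; all fibres have the
   same size. *)
rewrite (partition_big (fun f : {ffun _} => (f p, called f p)) valid) /=.
  rewrite (eq_bigr (fun=> p`! * (#|E| - p.+1)`!)%N).
    rewrite -(pair_big_dep (mem C) (fun x I => I \in indep_above M (C :\ x) p)
      (fun _ _ => p`! * (#|E| - p.+1)`!)%N) /=.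
    under eq_bigr => x xC do rewrite sum_nat_const (card_indep_above_circuit p cC xC eC).
    by rewrite sum_nat_const mulnA mulnAC -mulnA.
  case=> x I /andP[/= xC]; rewrite inE => /and3P[iI CI /eqP cI].
  have CxI : C \subset x |: I by rewrite -(setD1K xC) setUS.
  have /and4P[_ xI _ _] : [&& x \in C, x \notin I, indep M I & C :\ x \subset I].
    by rewrite -circuit_sub_setU1 iI CxI.
  rewrite -(card_called_fibre xI cI) -[RHS]sum1_card; apply: eq_bigl => f.
  rewrite !inE wins_ordS xpair_eqE -andbA [in RHS](andbC (_ == I)); congr (_ && _).
  by apply: andb_idl => /andP[/eqP-> /eqP->]; rewrite iI CxI.
move=> f; rewrite inE => /andP[uf]; rewrite wins_ordS circuit_sub_setU1.
by case/and4P => -> _ iI CI; rewrite inE iI CI card_called ?eqxx // ltnW.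
Qed.

End Winning.

(** Both sides share the factor [c^2 p!^2 (p+1) r!^2 (r+1)]. *)
Lemma wins_arith c p r u v w : ((r.+2 * p.+2) * (u * w) <= r.+1 * p.+1 * v ^ 2)%N ->
  ((c * (p`! * r.+2`!) * u) * (c * (p.+2`! * r`!) * w) <=
   (c * (p.+1`! * r.+1`!) * v) ^ 2)%N.
Proof.
move=> le_uv; rewrite !factS -mulnn.
move: (p`!) (r`!) => P F.
have := leq_mul (leqnn (c * c * P * P * p.+1 * F * F * r.+1)%N) le_uv.
rewrite -mulnn; lia.
Qed.

Theorem theorem3 (R : realFieldType) (n : nat) (E : finType) (hn : #|E| = n)
    (M : matroid E) (C : {set E}) (hC : circuit M C) :
  log_concave n (beta R M C).
Proof.
move=> i /andP[i_ge2 i_lt].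
(* With [i = p.+2], the rounds [i - 1], [i], [i + 1] correspond to independent sets of sizes [p],
   [p.+1], [p.+2]. *)
case: i i_ge2 i_lt => [|[|p]] // _ p_lt; rewrite /= in p_lt *.
have [e eC] : exists e, e \in C.
  apply/set0Pn; apply: contraTneq (minsetp hC) => ->; by rewrite negbK indep0.
pose N m := #|indep_above M (C :\ e) m|.
pose r := (n - p.+3)%N.
have cE : n = (r + p.+3)%N by rewrite /r; lia.
have winsE m : (m < n)%N -> #|[set s in orderings E | wins M C s m.+1]| =
    (#|C| * (m`! * (n - m.+1)`!) * N m)%N.
  by rewrite -hn => mE; apply: (card_wins hC (Ordinal mE) eC).
rewrite /beta mulf_div expr_div_n -expr2 ler_wpM2r ?invr_ge0 ?sqr_ge0 //.
rewrite -natrM -natrX ler_nat !winsE; try lia.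
have -> : (n - p.+1 = r.+2)%N by lia.
have -> : (n - p.+2 = r.+1)%N by lia.
rewrite -/r; apply: wins_arith.
have cD : #|C| = #|C :\ e|.+1 by rewrite (cardsD1 e) eC.
(* Sets of size [p] are too small to contain [C :\ e], so the left side vanishes. *)
have [lt_p|] := ltnP p #|C :\ e|.
  rewrite (_ : N p = 0)%N ?muln0 //; apply/eqP; rewrite cards_eq0.
  apply/eqP/setP => I; rewrite !inE; apply/negbTE/and3P => -[_ CI /eqP cI].
  by have := subset_leq_card CI; rewrite cI leqNgt lt_p.
move=> le_p; pose k := (p - #|C :\ e|)%N.
have def_p : p = (#|C :\ e| + k)%N by rewrite subnKC.
have := @indep_above_log_concave E M r k (C :\ e) (circuit_indepD1 hC eC).
rewrite !addnS -def_p -/(N _) -/(N _) -/(N _).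
(* Since [e] is a loop of the contraction, all nonloops lie outside [C]. *)
have card_nl : (#|[set x | x \notin C :\ e & indep M (x |: C :\ e)]| <= r.+2 + k)%N.
  have -> : (r.+2 + k = #|~: C|)%N by rewrite [RHS]cardsCs setCK hn cE cD; lia.
  apply/subset_leq_card/subsetP => x; rewrite !inE negb_and negbK.
  case/andP => /orP[/eqP->|//]; rewrite setD1K // => iC.
  by have := circuit_dep hC iC; rewrite subxx.
move/(_ card_nl) => le_N; move: (N p) (N p.+1) (N p.+2) le_N => u v w le_uv.
rewrite -(@leq_pmul2l k.+1) //.
(* As [k <= p], the factor [(k+2)/(k+1)] is at least [(p+2)/(p+1)]. *)
have le_kp : (k.+1 * p.+2 <= p.+1 * k.+2)%N by rewrite /k; nia.
have := leq_mul (leqnn p.+1) le_uv; have := leq_mul le_kp (leqnn (r.+2 * (u * w))%N).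
rewrite -mulnn; lia.
Qed.
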